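(* Let $\boldsymbol\Omega$ be a trisymplectic structure generating a holomorphic $SL(2)$-web on a complex manifold $M$, and let $\nabla$ be the corresponding Chern connection. Then $\nabla\Omega=0$ for each $\Omega\in\boldsymbol\Omega$.
   Context: Trisymplectic structure on a complex manifold $M$: a 3-dimensional space $\boldsymbol\Omega$ of closed holomorphic 2-forms such that for every $x\in M$ the evaluation $\boldsymbol\Omega(x)$ is a 3-dimensional space of 2-forms on $T_xM$ with: (i) $\boldsymbol\Omega(x)$ contains a non-degenerate form; (ii) every nonzero degenerate form in $\boldsymbol\Omega(x)$ has rank $\frac12\dim T_xM$; (iii) the set of degenerate forms lies in a non-degenerate quadric in $\boldsymbol\Omega(x)$. Holomorphic $SL(2)$-web: a family $S_t\subset TM$, $t\in\mathbb{CP}^1$, of holomorphic sub-bundles of rank $n$, where $\dim_{\mathbb C}M=2n$, such that (i) each $S_t$ is involutive; (ii) $S_t\cap S_{t'}=0$ for $t\neq t'$; (iii) the projections $P_{t,t'}$ of $TM$ onto $S_t$ along $S_{t'}$ generate a rank 4 sub-bundle of $\mathrm{End}(TM)$ closed under multiplication; (iv) each fiber of this sub-bundle is isomorphic to the algebra $\mathrm{Mat}(2)$ of $2\times2$ complex matrices. $\boldsymbol\Omega$ generates the $SL(2)$-web $S_t$ if for each $t\in\mathbb{CP}^1$ there is $\Omega_t\in\boldsymbol\Omega$ with $S_t=\{v\in T^{1,0}M:\iota_v\Omega_t=0\}$. A holomorphic connection on a holomorphic vector bundle $B$ is a holomorphic differential operator $\nabla:B\to B\otimes\Omega^1M$ satisfying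 the Leibniz rule with respect to holomorphic functions. The Chern connection of an $SL(2)$-web is the unique torsion-free holomorphic connection on $TM$ preserving $S_t$ for all $t\in\mathbb{CP}^1$ (existence and uniqueness are known); it is extended to differential forms in the usual way. *)

(* Defs.v *)
(* MathComp / MathComp-Analysis *)
From HB Require Import structures.
From mathcomp Require Import all_boot all_order all_algebra.
From mathcomp Require Import all_classical all_reals all_analysis.
Set Implicit Arguments.
Unset Strict Implicit.
Unset Printing Implicit Defensive.
Import Order.TTheory GRing.Theory Num.Theory.
Import numFieldNormedType.Exports.
Local Open Scope classical_set_scope.
Local Open Scope ring_scope.

(* Complex manifolds of dimension m, given by a holomorphic atlas.  C stands
   for the field of complex numbers: the definitions are meant for C = R[i]
   with R : realType, and are written for a numFieldType because this is the
   generality at which the library provides norms and differentials.  All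
   normed modules below are over C, so [differentiable] means complex
   differentiable, i.e. holomorphic when required on an open set.
   [mf_psi i] is the inverse of the chart [mf_phi i] (junk outside the image
   of the chart).  [mf_at x] selects a chart around x; it is only used to
   give the tangent space at x a concrete model, see below. *)
Record complex_manifold (C : numFieldType) (m : nat) := ComplexManifold {
  mf_pt :> topologicalType;
  mf_hausdorff : hausdorff_space mf_pt;
  mf_countable : @second_countable mf_pt;
  mf_atlas : Type;
  mf_dom : mf_atlas -> set mf_pt;
  mf_phi : mf_atlas -> mf_pt -> 'rV[C]_m;
  mf_psi : mf_atlas -> 'rV[C]_m -> mf_pt;
  mf_at : mf_pt -> mf_atlas;
  mf_atP : forall x, mf_dom (mf_at x) x;
  mf_dom_open : forall i, open (mf_dom i);
  mf_cod_open : forall i, open [set mf_phi i x | x in mf_dom i];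
  mf_phiK : forall i x, mf_dom i x -> mf_psi i (mf_phi i x) = x;
  mf_phi_continuous : forall i x, mf_dom i x ->
    {for x, continuous (mf_phi i)};
  mf_psi_continuous : forall i x, mf_dom i x ->
    {for mf_phi i x, continuous (mf_psi i)};
  mf_transition : forall i j x, mf_dom i x -> mf_dom j x ->
    differentiable (mf_phi j \o mf_psi i) (mf_phi i x)
}.

(* The complex projective line: lines through the origin of C^2. *)
Definition CP1 (C : numFieldType) : Type :=
  {L : {vspace 'rV[C]_2} | \dim L == 1%N}.

Section Tensors.
Context {C : numFieldType} {m : nat} (M : complex_manifold C m).
Local Notation atlas := (mf_atlas M).

(* The holomorphic tangent space at x is 'rV_m, through the chart [mf_at x];
   v : 'rV_m stands for the vector with components v in that chart.
   [jac i x] is the matrix (acting on row vectors from the right) that turns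
   these components into the components in another chart i around x.
   Accordingly a vector field is a function M -> 'rV_m, a 2-form is a function
   M -> 'M_m (u, v |-> u *m W *m v^T), an endomorphism of TM is a function
   M -> 'M_m (v |-> v *m A). *)
Definition jac (i : atlas) (x : M) : 'M[C]_m :=
  'J (mf_phi i \o mf_psi (mf_at x)) (mf_phi (mf_at x) x).

Definition fun_rep (i : atlas) (x : M) (a : C) : C := a.
Definition vec_rep (i : atlas) (x : M) (v : 'rV[C]_m) : 'rV[C]_m :=
  v *m jac i x.
Definition end_rep (i : atlas) (x : M) (A : 'M[C]_m) : 'M[C]_m :=
  invmx (jac i x) *m A *m jac i x.
Definition form_rep (i : atlas) (x : M) (W : 'M[C]_m) : 'M[C]_m :=
  invmx (jac i x) *m W *m (invmx (jac i x))^T.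

Definition in_chart {F : Type} (rep : atlas -> M -> F -> F)
    (i : atlas) (s : M -> F) : 'rV[C]_m -> F :=
  fun z => rep i (mf_psi i z) (s (mf_psi i z)).

Definition holomorphic_on {F : normedModType C}
    (rep : atlas -> M -> F -> F) (U : set M) (s : M -> F) : Prop :=
  forall i x, U x -> mf_dom i x ->
    differentiable (in_chart rep i s) (mf_phi i x).

Definition differential (f : M -> C) (x : M) (v : 'rV[C]_m) : C :=
  'd (in_chart fun_rep (mf_at x) f) (mf_phi (mf_at x) x) v.

Definition lie_bracket (X Y : M -> 'rV[C]_m) (x : M) : 'rV[C]_m :=
  let z := mf_phi (mf_at x) x in
  let X' := in_chart vec_rep (mf_at x) X in
  let Y' := in_chart vec_rep (mf_at x) Y in
  'd Y' z (X' z) - 'd X' z (Y' z).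

Definition form_eval (W : 'M[C]_m) (u v : 'rV[C]_m) : C :=
  (u *m W *m v^T) 0 0.

(* (d w)_x (u1, u2, u3); the coordinate vector fields of the chart commute,
   so only the three derivative terms of the invariant formula remain. *)
Definition exterior_derivative (w : M -> 'M[C]_m) (x : M)
    (u1 u2 u3 : 'rV[C]_m) : C :=
  let z := mf_phi (mf_at x) x in
  let w' := in_chart form_rep (mf_at x) w in
  form_eval ('d w' z u1) u2 u3 + form_eval ('d w' z u2) u3 u1
    + form_eval ('d w' z u3) u1 u2.

Definition closed_holomorphic_2form (w : M -> 'M[C]_m) : Prop :=
  [/\ forall x, (w x)^T = - w x,
      holomorphic_on form_rep setT w
    & forall x u1 u2 u3, exterior_derivative w x u1 u2 u3 = 0].

(* A family E of subspaces of the fibres is a holomorphic sub-bundle of rank r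
   if it has local holomorphic frames. *)
Definition holomorphic_subbundle (p q : nat)
    (rep : atlas -> M -> 'M[C]_(p, q) -> 'M[C]_(p, q)) (r : nat)
    (E : M -> {vspace 'M[C]_(p, q)}) : Prop :=
  forall x0 : M, exists U : set M, [/\ open U, U x0
    & exists2 s : 'I_r -> M -> 'M[C]_(p, q),
        forall k, holomorphic_on rep U (s k)
      & forall x, U x -> basis_of (E x) [tuple s k x | k < r]].

Definition involutive (E : M -> {vspace 'rV[C]_m}) : Prop :=
  forall (U : set M) (X Y : M -> 'rV[C]_m), open U ->
    holomorphic_on vec_rep U X -> holomorphic_on vec_rep U Y ->
    (forall x, U x -> X x \in E x) -> (forall x, U x -> Y x \in E x) ->
    forall x, U x -> lie_bracket X Y x \in E x.

Section Trisymplectic.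
Variable Om : set (M -> 'M[C]_m).

Definition three_dimensional : Prop :=
  exists b : 'I_3 -> M -> 'M[C]_m,
    (forall c : 'I_3 -> C,
       (forall x, \sum_k c k *: b k x = 0) -> forall k, c k = 0) /\
    Om = [set w | exists c : 'I_3 -> C, w = fun x => \sum_k c k *: b k x].

Definition is_evaluation (x : M) (V : {vspace 'M[C]_m}) : Prop :=
  forall W, W \in V <-> exists2 w, Om w & w x = W.

(* A quadric of V is the zero locus of a quadratic form, here a symmetric
   matrix Q in the coordinates of a basis of V. *)
Definition degenerate_in_quadric (V : {vspace 'M[C]_m}) : Prop :=
  exists Q : 'M[C]_(\dim V), [/\ Q^T = Q, Q \in unitmx
    & forall W, W \in V -> W \notin unitmx ->
        let c := \row_k coord (vbasis V) k W in c *m Q *m c^T = 0].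

Record trisymplectic : Prop := Trisymplectic {
  tri_dim : three_dimensional;
  tri_form : forall w, Om w -> closed_holomorphic_2form w;
  tri_eval : forall x, exists V : {vspace 'M[C]_m},
    [/\ is_evaluation x V, \dim V = 3%N,
        exists2 W, W \in V & W \in unitmx,
        forall W, W \in V -> W != 0 -> W \notin unitmx -> (\rank W).*2 = m
      & degenerate_in_quadric V]
}.

End Trisymplectic.

(* A connection is a morphism of sheaves of holomorphic sections.  It is
   encoded as an operator on all vector fields X : M -> 'rV_m, constrained
   only on open sets where X is holomorphic; [con_local] says that there
   nabla X only depends on X, so the operator induces one on local sections.
   The covariant derivative of X along v at x is [v *m nabla X x]. *)
Record holomorphic_connection (nabla : (M -> 'rV[C]_m) -> M -> 'M[C]_m) :
    Prop := HolomorphicConnection {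
  con_local : forall U X Y, open U ->
    holomorphic_on vec_rep U X -> holomorphic_on vec_rep U Y ->
    (forall x, U x -> X x = Y x) -> forall x, U x -> nabla X x = nabla Y x;
  con_holomorphic : forall U X, open U ->
    holomorphic_on vec_rep U X -> holomorphic_on end_rep U (nabla X);
  con_add : forall U X Y, open U ->
    holomorphic_on vec_rep U X -> holomorphic_on vec_rep U Y ->
    forall x, U x -> nabla (fun y => X y + Y y) x = nabla X x + nabla Y x;
  con_leibniz : forall U (f : M -> C) X, open U ->
    holomorphic_on fun_rep U f -> holomorphic_on vec_rep U X ->
    forall x v, U x ->
      v *m nabla (fun y => f y *: X y) x =
      differential f x v *: X x + f x *: (v *m nabla X x)
}.

Definition torsion_free (nabla : (M -> 'rV[C]_m) -> M -> 'M[C]_m) : Prop :=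
  forall U X Y, open U ->
    holomorphic_on vec_rep U X -> holomorphic_on vec_rep U Y ->
    forall x, U x ->
      X x *m nabla Y x - Y x *m nabla X x = lie_bracket X Y x.

Definition preserves (nabla : (M -> 'rV[C]_m) -> M -> 'M[C]_m)
    (E : M -> {vspace 'rV[C]_m}) : Prop :=
  forall U X, open U -> holomorphic_on vec_rep U X ->
    (forall x, U x -> X x \in E x) ->
    forall x v, U x -> v *m nabla X x \in E x.

(* (nabla_v w)(X, Y) at x. *)
Definition covariant_form (nabla : (M -> 'rV[C]_m) -> M -> 'M[C]_m)
    (w : M -> 'M[C]_m) (X Y : M -> 'rV[C]_m) (x : M) (v : 'rV[C]_m) : C :=
  differential (fun y => form_eval (w y) (X y) (Y y)) x v
    - form_eval (w x) (v *m nabla X x) (Y x)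
    - form_eval (w x) (X x) (v *m nabla Y x).

Definition parallel_form (nabla : (M -> 'rV[C]_m) -> M -> 'M[C]_m)
    (w : M -> 'M[C]_m) : Prop :=
  forall U X Y, open U ->
    holomorphic_on vec_rep U X -> holomorphic_on vec_rep U Y ->
    forall x v, U x -> covariant_form nabla w X Y x v = 0.

End Tensors.

Section Web.
Context {C : numFieldType} {n : nat} (M : complex_manifold C n.*2).
Variable S : CP1 C -> M -> {vspace 'rV[C]_n.*2}.

(* The projection of the tangent space at x onto S t x along S t' x. *)
Definition web_proj (t t' : CP1 C) (x : M) : 'M[C]_n.*2 :=
  lin1_mx (daddv_pi (S t x) (S t' x)).

Definition spanned_by_projections (x : M) (A : {vspace 'M[C]_n.*2}) : Prop :=
  (forall t t', t <> t' -> web_proj t t' x \in A) /\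
  (forall A' : {vspace 'M[C]_n.*2},
     (forall t t', t <> t' -> web_proj t t' x \in A') -> (A <= A')%VS).

Definition algebra_iso_Mat2 (A : {vspace 'M[C]_n.*2}) : Prop :=
  exists f : {linear 'M[C]_2 -> 'M[C]_n.*2},
    [/\ injective f, forall a b, f (a *m b) = f a *m f b
      & forall B, B \in A <-> exists a, f a = B].

Record sl2_web : Prop := SL2Web {
  web_subbundle : forall t, holomorphic_subbundle (@vec_rep _ _ M) n (S t);
  web_involutive : forall t, involutive (S t);
  web_disjoint : forall t t', t <> t' ->
    forall x, (S t x :&: S t' x = 0)%VS;
  web_algebra : exists A : M -> {vspace 'M[C]_n.*2},
    [/\ forall x, spanned_by_projections x (A x),
        holomorphic_subbundle (@end_rep _ _ M) 4 A,
        forall x B B', B \in A x -> B' \in A x -> B *m B' \in A x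
      & forall x, algebra_iso_Mat2 (A x)]
}.

Definition generates_web (Om : set (M -> 'M[C]_n.*2)) : Prop :=
  forall t, exists2 w, Om w & forall x v, v \in S t x <-> v *m w x = 0.

Definition chern_connection
    (nabla : (M -> 'rV[C]_n.*2) -> M -> 'M[C]_n.*2) : Prop :=
  [/\ holomorphic_connection nabla, torsion_free nabla
    & forall t, preserves nabla (S t)].

End Web.

(* Main.v *)
(* Take four points of CP^1, with sub-bundles S_i and forms w_i of kernel S_i.
   As Om is three-dimensional there is a relation sum_i a_i w_i = 0 with constant
   coefficients, and on S_k x S_l only w_i and w_j survive in it; hence no a_i
   vanishes, and any three of the w_i span Om.  Since nabla preserves S_i, the
   form nabla_v w_i is killed by S_i, so closedness of w_i and vanishing torsion
   give nabla_v w_i = 0 for v in S_i.  For v in S_j, apply nabla_v to the relation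
   and restrict to S_k x S_l: nabla_v w_k and nabla_v w_l vanish there, and
   nabla_v w_j = 0, so nabla_v w_i vanishes on S_k x S_l, hence everywhere because
   S_i is a complement of both S_k and S_l.  Finally TM = S_i + S_j. *)

Require Import Defs.
From mathcomp Require Import all_boot all_order all_algebra.
From mathcomp Require Import all_classical all_reals all_analysis.
From mathcomp Require Import complex ring.
Set Implicit Arguments.
Unset Strict Implicit.
Unset Printing Implicit Defensive.
Import Order.TTheory GRing.Theory Num.Theory.
Import numFieldNormedType.Exports.
Local Open Scope classical_set_scope.
Local Open Scope ring_scope.
Local Open Scope complex_scope.

(** * Differentials of matrix-valued maps *)

Section MatrixDifferential.
Context {C : numFieldType} {V : normedModType C}.
Implicit Type x : V.

(** The first-order expansion of [f] is also one of [g], as it involves only the germ at [x]. Chart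
    representatives are known to satisfy the expected formulas only near a point, so they are
    compared through this lemma. *)
Lemma is_diff_near_eq (W : normedModType C) (f g df : V -> W) x :
  (\forall y \near x, f y = g y) -> is_diff x f df -> is_diff x g df.
Proof.
move=> fg [dfx dfE]; have fgx : f x = g x by have := nbhs_singleton fg.
have gE : g \o shift x = cst (g x) + 'd f x +o_ 0 id.
  apply/eqaddoP => e e0.
  have /eqaddoP/(_ e e0) fo := diff_locally dfx.
  have fg0 : \forall h \near (0 : V), f (h + x) = g (h + x).
    by move: fg; rewrite (near_shift 0) /=; apply: filterS => h; rewrite /= subr0.
  by apply: filterS2 fg0 fo => h; rewrite !fctE /= fgx => ->.
have dgE : 'd g x = 'd f x :> (V -> W).
  by apply: diff_unique => //; exact: diff_continuous.
apply: DiffDef; last by rewrite dgE.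
by apply/diff_locallyP; rewrite dgE; split => //; exact: diff_continuous.
Qed.

Lemma differentiable_near_eq (W : normedModType C) (f g : V -> W) x :
  (\forall y \near x, f y = g y) -> differentiable f x -> differentiable g x.
Proof. by move=> fg /differentiableP/(is_diff_near_eq fg)[]. Qed.

Lemma is_diff_sum (W : normedModType C) (I : Type) (r : seq I)
    (f df : I -> V -> W) x :
  (forall i, is_diff x (f i) (df i)) ->
  is_diff x (fun y => \sum_(i <- r) f i y) (fun v => \sum_(i <- r) df i v).
Proof.
move=> fdf; elim: r => [|i r IH].
  rewrite (_ : (fun y => _) = cst 0); last by apply/funext => y; rewrite big_nil.
  rewrite (_ : (fun v => _) = 0); last by apply/funext => y; rewrite big_nil.
  exact: is_diff_cst.
under eq_fun do rewrite big_cons.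
rewrite [X in is_diff _ _ X](_ : _ = df i + (fun v => \sum_(i <- r) df i v)).
  exact: is_diffD.
by apply/funext => v; rewrite big_cons.
Qed.

Lemma is_diff_mx (p q : nat) (F dF : V -> 'M[C]_(p, q)) x :
  (forall i j, is_diff x (fun y => F y i j : C) (fun v => dF v i j)) ->
  is_diff x F dF.
Proof.
move=> FdF.
rewrite (_ : F = fun y => \sum_i \sum_j F y i j *: delta_mx i j); last first.
  by apply/funext => y; rewrite [LHS]matrix_sum_delta.
rewrite (_ : dF = fun v => \sum_i \sum_j dF v i j *: delta_mx i j); last first.
  by apply/funext => y; rewrite [LHS]matrix_sum_delta.
apply: is_diff_sum => i; apply: is_diff_sum => j.
have [Fij dFij] := FdF i j.
by apply: DiffDef; [exact: differentiableZl | rewrite diffZl// dFij].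
Qed.

Lemma is_diff_coord (p q : nat) (F dF : V -> 'M[C]_(p, q)) x i j :
  is_diff x F dF -> is_diff x (fun y => F y i j : C) (fun v => dF v i j).
Proof.
move=> FdF.
have @f : {linear 'M[C]_(p, q) -> C}.
  by exists (fun N : 'M[C]_(_, _) => N i j); do 2![eexists]; do ?[constructor];
     rewrite ?mxE// => ? *; rewrite ?mxE//; move=> ?; rewrite !mxE.
have cf : continuous f by exact: coord_continuous.
have fdf : is_diff (F x) f f.
  by apply: DiffDef; [exact: linear_differentiable | exact: diff_lin].
exact: (is_diff_comp FdF fdf).
Qed.

Lemma is_diff_mulmx (p q r : nat) (F dF : V -> 'M[C]_(p, q))
    (G dG : V -> 'M[C]_(q, r)) x :
  is_diff x F dF -> is_diff x G dG ->
  is_diff x (fun y => F y *m G y) (fun v => dF v *m G x + F x *m dG v).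
Proof.
move=> FdF GdG; apply: is_diff_mx => i j.
rewrite [X in is_diff _ X _](_ : _ = fun y => \sum_k F y i k * G y k j); last first.
  by apply/funext => y; rewrite mxE.
rewrite [X in is_diff _ _ X](_ : _ =
    fun v => \sum_k (F x i k * dG v k j + G x k j * dF v i k)); last first.
  apply/funext => v; rewrite !mxE -big_split; apply: eq_bigr => k _ /=.
  by rewrite addrC [dF v i k * _]mulrC.
apply: is_diff_sum => k.
exact: (is_diffM (is_diff_coord i k FdF) (is_diff_coord k j GdG)).
Qed.

Lemma is_diff_trmx (p q : nat) (F dF : V -> 'M[C]_(p, q)) x :
  is_diff x F dF -> is_diff x (fun y => (F y)^T) (fun v => (dF v)^T).
Proof.
move=> FdF; apply: is_diff_mx => i j.
rewrite [X in is_diff _ X _](_ : _ = fun y => F y j i); last first.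
  by apply/funext => y; rewrite mxE.
rewrite [X in is_diff _ _ X](_ : _ = fun v => dF v j i); last first.
  by apply/funext => v; rewrite mxE.
exact: is_diff_coord.
Qed.

Lemma differentiable_mx (p q : nat) (F : V -> 'M[C]_(p, q)) x :
  (forall i j, differentiable (fun y => F y i j : C) x) -> differentiable F x.
Proof.
move=> dF.
have /is_diff_mx[] // : forall i j, is_diff x (fun y => F y i j : C)
    (fun v => (\matrix_(i, j) 'd (fun y => F y i j : C) x v) i j).
  move=> i j; rewrite [X in is_diff _ _ X](_ : _ =
    'd (fun y => F y i j : C) x :> (V -> C)).
    exact: differentiableP.
  by apply/funext => v; rewrite mxE.
Qed.

Lemma differentiable_entry (p q : nat) (F : V -> 'M[C]_(p, q)) x i j :
  differentiable F x -> differentiable (fun y => F y i j : C) x.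
Proof. by move=> /differentiableP/(is_diff_coord i j)[]. Qed.

Lemma differentiable_mulmx (p q r : nat) (F : V -> 'M[C]_(p, q))
    (G : V -> 'M[C]_(q, r)) x :
  differentiable F x -> differentiable G x ->
  differentiable (fun y => F y *m G y) x.
Proof.
by move=> /differentiableP dF /differentiableP dG; case: (is_diff_mulmx dF dG).
Qed.

Lemma differentiable_prod (I : Type) (r : seq I) (f : I -> V -> C) x :
  (forall i, differentiable (f i) x) ->
  differentiable (fun y => \prod_(i <- r) f i y) x.
Proof.
move=> df; elim: r => [|i r IH].
  rewrite [X in differentiable X _](_ : _ = cst 1); last first.
    by apply/funext => y; rewrite big_nil.
  exact: differentiable_cst.
rewrite [X in differentiable X _](_ : _ =
  f i * (fun y => \prod_(i <- r) f i y)); last first.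
  by apply/funext => y; rewrite big_cons.
exact: differentiableM.
Qed.

Lemma differentiable_bigsum (W : normedModType C) (I : Type) (r : seq I)
    (f : I -> V -> W) x :
  (forall i, differentiable (f i) x) ->
  differentiable (fun y => \sum_(i <- r) f i y) x.
Proof. by move=> df; case: (is_diff_sum r (fun i => differentiableP (df i))). Qed.

Lemma differentiable_det (p : nat) (F : V -> 'M[C]_p) x :
  differentiable F x -> differentiable (fun y => \det (F y)) x.
Proof.
move=> dF; apply: differentiable_bigsum => s.
apply: (differentiableM (f := cst _)); first exact: differentiable_cst.
by apply: differentiable_prod => i; exact: differentiable_entry.
Qed.

Lemma differentiable_adj (p : nat) (F : V -> 'M[C]_p) x :
  differentiable F x -> differentiable (fun y => \adj (F y)) x.
Proof.
move=> dF; apply: differentiable_mx => i j.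
rewrite [X in differentiable X _](_ : _ = cst ((-1) ^+ (j + i)) *
    (fun y => \det (row' j (col' i (F y))))); last first.
  by apply/funext => y; rewrite mxE.
apply: differentiableM; first exact: differentiable_cst.
apply: differentiable_det; apply: differentiable_mx => k l.
rewrite [X in differentiable X _](_ : _ =
  fun y => F y (lift j k) (lift i l)); last first.
  by apply/funext => y; rewrite !mxE.
exact: differentiable_entry.
Qed.

Lemma differentiable_invmx (p : nat) (F : V -> 'M[C]_p) x :
  differentiable F x -> (\forall y \near x, F y \in unitmx) ->
  differentiable (fun y => invmx (F y)) x.
Proof.
move=> dF Fu.
(* [invmx] is given by Cramer's formula on invertible matrices and returns its argument elsewhere,
   so agreement is claimed only near [x]. *)
apply: (@differentiable_near_eq _ (fun y => (\det (F y))^-1 *: \adj (F y))).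
  by apply: filterS Fu => y Fy; rewrite /invmx Fy.
apply: differentiable_mx => i j.
rewrite [X in differentiable X _](_ : _ =
    (fun y => (\det (F y))^-1) * (fun y => (\adj (F y)) i j)); last first.
  by apply/funext => y; rewrite mxE.
apply: differentiableM; last exact/differentiable_entry/differentiable_adj.
apply: differentiableV; first exact: differentiable_det.
by rewrite -unitfE -unitmxE; exact: nbhs_singleton Fu.
Qed.

End MatrixDifferential.

(** * Changes of charts and holomorphic frames *)

Section Charts.
Context {C : numFieldType} {m : nat} (M : complex_manifold C m).
Local Notation atlas := (mf_atlas M).
Implicit Types (i : atlas) (x : M) (U : set M).
Local Notation chart x := (mf_at x).

(** [mf_psi i] is arbitrary outside the image of the chart, so identities between chart
    representatives are proved on such a neighbourhood. It exists because the image is open and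
    [mf_psi i] is continuous at [mf_phi i x]. *)
Lemma near_chart i x U : open U -> U x -> mf_dom i x ->
  \forall z \near mf_phi i x,
    [/\ U (mf_psi i z), mf_dom i (mf_psi i z) & mf_phi i (mf_psi i z) = z].
Proof.
move=> oU Ux ix.
have nU : nbhs (mf_phi i x) (mf_psi i @^-1` (U `&` mf_dom i)).
  apply: mf_psi_continuous => //; rewrite mf_phiK//.
  by apply: open_nbhs_nbhs; split => //; exact/openI/mf_dom_open.
have nphi : nbhs (mf_phi i x) [set mf_phi i x | x in mf_dom i].
  by apply: open_nbhs_nbhs; split; [exact: mf_cod_open | exists x].
apply: filterS2 nU nphi => z [Uz iz] [y iy yz].
by split => //; rewrite -yz mf_phiK.
Qed.

(** Chain rule: the composite of two opposite transition maps is the identity near the point, hence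
    so is its differential. *)
Lemma diff_transitionK i j x : mf_dom i x -> mf_dom j x ->
  'J (mf_phi i \o mf_psi j) (mf_phi j x) *m
    'J (mf_phi j \o mf_psi i) (mf_phi i x) = 1%:M.
Proof.
move=> ix jx.
have dij := mf_transition jx ix.
have dji : differentiable (mf_phi j \o mf_psi i)
    ((mf_phi i \o mf_psi j) (mf_phi j x)).
  by rewrite /= mf_phiK//; exact: mf_transition.
apply/row_matrixP => k; rewrite !rowE mulmx1 mulmxA !mul_rV_lin1.
have := congr1 (@^~ (delta_mx 0 k)) (diff_comp dij dji).
rewrite [X in _ = X]/= mf_phiK// => <-.
have [_ ->] // : is_diff (mf_phi j x)
    ((mf_phi j \o mf_psi i) \o (mf_phi i \o mf_psi j)) id.
apply: is_diff_near_eq (is_diff_id _).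
have := near_chart (mf_dom_open i) ix jx; apply: filterS => z [iz jz /= zE].
by rewrite mf_phiK.
Qed.

Lemma jac_unit i x : mf_dom i x -> jac i x \in unitmx.
Proof.
by move=> ix; case: (mulmx1_unit (diff_transitionK ix (mf_atP x))) => + _.
Qed.

Lemma jac_mf_at x : jac (chart x) x = 1%:M.
Proof.
apply/row_matrixP => k; rewrite !rowE mul_rV_lin1 mulmx1.
have [_ ->] // : is_diff (mf_phi (chart x) x)
    (mf_phi (chart x) \o mf_psi (chart x)) id.
apply: is_diff_near_eq (is_diff_id _).
have := near_chart (mf_dom_open (chart x)) (mf_atP x) (mf_atP x).
by apply: filterS => z [].
Qed.

Lemma form_eval_rep i x (W : 'M[C]_m) (u v : 'rV[C]_m) : mf_dom i x ->
  form_eval (form_rep i x W) (vec_rep i x u) (vec_rep i x v) = form_eval W u v.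
Proof.
move=> ix; rewrite /form_eval /form_rep /vec_rep.
rewrite trmx_mul !mulmxA mulmxK ?jac_unit//.
by rewrite -(mulmxA _ _ (jac i x)^T) -trmx_mul mulmxV ?jac_unit// trmx1 mulmx1.
Qed.

Lemma in_chart_at (F : Type) (rep : atlas -> M -> F -> F) (s : M -> F) x :
  in_chart rep (chart x) s (mf_phi (chart x) x) = rep (chart x) x (s x).
Proof. by rewrite /in_chart mf_phiK//; exact: mf_atP. Qed.

Lemma vec_rep_at x (v : 'rV[C]_m) : vec_rep (chart x) x v = v.
Proof. by rewrite /vec_rep jac_mf_at mulmx1. Qed.

Lemma form_rep_at x (W : 'M[C]_m) : form_rep (chart x) x W = W.
Proof. by rewrite /form_rep jac_mf_at invmx1 mul1mx trmx1 mulmx1. Qed.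

Lemma holomorphic_onS (F : normedModType C) (rep : atlas -> M -> F -> F)
    U U' (s : M -> F) :
  U' `<=` U -> holomorphic_on rep U s -> holomorphic_on rep U' s.
Proof. by move=> U'U hs i x U'x ix; apply: hs => //; exact: U'U. Qed.

Lemma holomorphic_vecD U (X Y : M -> 'rV[C]_m) :
  holomorphic_on (@vec_rep _ _ M) U X -> holomorphic_on (@vec_rep _ _ M) U Y ->
  holomorphic_on (@vec_rep _ _ M) U (fun y => X y + Y y).
Proof.
move=> hX hY i x Ux ix.
rewrite [X in differentiable X _](_ : _ =
    in_chart (@vec_rep _ _ M) i X + in_chart (@vec_rep _ _ M) i Y).
  by apply: differentiableD; [exact: hX | exact: hY].
by apply/funext => z; rewrite /in_chart /vec_rep mulmxDl.
Qed.

Lemma holomorphic_combination U (n : nat) (s : 'I_n -> M -> 'rV[C]_m)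
    (c : 'I_n -> C) : (forall k, holomorphic_on (@vec_rep _ _ M) U (s k)) ->
  holomorphic_on (@vec_rep _ _ M) U (fun y => \sum_k c k *: s k y).
Proof.
move=> hs i x Ux ix.
rewrite [X in differentiable X _](_ : _ =
    fun z => \sum_k c k *: in_chart (@vec_rep _ _ M) i (s k) z).
  apply: differentiable_bigsum => k.
  by apply: (@differentiableZ _ _ _ (in_chart _ i (s k))); exact: hs.
apply/funext => z; rewrite /in_chart /vec_rep mulmx_suml.
by apply: eq_bigr => k _; rewrite scalemxAl.
Qed.

Definition frame_mx (e : 'I_m -> M -> 'rV[C]_m) (y : M) : 'M[C]_m :=
  \matrix_k e k y.

(** For [D] a diagonal matrix with entries 0 and 1, the new field is the part of [X] carried by a
    subset of the frame. *)
Lemma holomorphic_frame_transform U (e : 'I_m -> M -> 'rV[C]_m)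
    (X : M -> 'rV[C]_m) (D : 'M[C]_m) : open U ->
  (forall k, holomorphic_on (@vec_rep _ _ M) U (e k)) ->
  (forall y, U y -> frame_mx e y \in unitmx) ->
  holomorphic_on (@vec_rep _ _ M) U X ->
  holomorphic_on (@vec_rep _ _ M) U
    (fun y => X y *m invmx (frame_mx e y) *m D *m frame_mx e y).
Proof.
move=> oU he eu hX i x Ux ix.
pose X' := in_chart (@vec_rep _ _ M) i X.
(* [jac i] alone need not vary holomorphically, since the reference chart [mf_at] may jump from
   point to point. Its factors are absorbed into [X'] and [G], which are holomorphic. *)
pose G z : 'M[C]_m := \matrix_k in_chart (@vec_rep _ _ M) i (e k) z.
have GE z : G z = frame_mx e (mf_psi i z) *m jac i (mf_psi i z).
  by apply/row_matrixP => k; rewrite row_mul !rowK.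
have nx := near_chart oU Ux ix.
apply: (@differentiable_near_eq _ _ _ (fun z => X' z *m invmx (G z) *m D *m G z)).
  apply: filterS nx => z [Uz iz _]; rewrite GE /X' /in_chart /vec_rep.
  have Gu := eu _ Uz; have Ju := jac_unit iz.
  rewrite -[in RHS]mulmxA; congr (_ *m _ *m _).
  have -> : invmx (frame_mx e (mf_psi i z) *m jac i (mf_psi i z)) =
      invmx (jac i (mf_psi i z)) *m invmx (frame_mx e (mf_psi i z)).
    apply: (can_inj (mulmxK Gu)); apply: (can_inj (mulmxK Ju)).
    by rewrite mulmxKV// mulVmx// -mulmxA mulVmx// unitmx_mul Gu.
  by rewrite mulmxA mulmxK.
have dG : differentiable G (mf_phi i x).
  apply: differentiable_mx => k l.
  rewrite [X in differentiable X _](_ : _ =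
      fun z => (in_chart (@vec_rep _ _ M) i (e k) z) 0 l).
    by apply: differentiable_entry; exact: he.
  by apply/funext => z; rewrite mxE.
apply: differentiable_mulmx => //.
apply: differentiable_mulmx; last exact: (differentiable_cst D).
apply: differentiable_mulmx; first exact: hX.
apply: differentiable_invmx => //; apply: filterS nx => z [Uz iz _].
by rewrite GE unitmx_mul eu// jac_unit.
Qed.

End Charts.

(** * The bilinear form attached to a matrix *)

Section FormEval.
Context {C : numFieldType} {m : nat}.
Implicit Types (W : 'M[C]_m) (u v : 'rV[C]_m).

Lemma form_eval0 u v : form_eval 0 u v = 0.
Proof. by rewrite /form_eval mulmx0 mul0mx mxE. Qed.

Lemma form_evalDl W u u' v :
  form_eval W (u + u') v = form_eval W u v + form_eval W u' v.
Proof. by rewrite /form_eval !mulmxDl mxE. Qed.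

Lemma form_evalNl W u v : form_eval W (- u) v = - form_eval W u v.
Proof. by rewrite /form_eval !mulNmx mxE. Qed.

Lemma form_evalDr W u v v' :
  form_eval W u (v + v') = form_eval W u v + form_eval W u v'.
Proof. by rewrite /form_eval linearD mulmxDr mxE. Qed.

Lemma form_eval_sum (I : finType) (a : I -> C) (W : I -> 'M[C]_m) u v :
  form_eval (\sum_k a k *: W k) u v = \sum_k a k * form_eval (W k) u v.
Proof.
rewrite /form_eval mulmx_sumr mulmx_suml summxE; apply: eq_bigr => k _.
by rewrite -scalemxAr -scalemxAl mxE.
Qed.

Lemma form_eval_skew W u v : W^T = - W -> form_eval W u v = - form_eval W v u.
Proof.
move=> WT; rewrite /form_eval.
have -> : v *m W *m u^T = - (u *m W *m v^T)^T.
  by rewrite !trmx_mul WT trmxK mulmxA mulmxN mulNmx opprK.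
by rewrite !mxE opprK.
Qed.

Lemma form_eval_ker W u v : u *m W = 0 -> form_eval W u v = 0.
Proof. by move=> uW; rewrite /form_eval uW mul0mx mxE. Qed.

Lemma form_eval_ext W : (forall u v, form_eval W u v = 0) -> W = 0.
Proof.
move=> W0; apply/matrixP => i j; have := W0 (delta_mx 0 i) (delta_mx 0 j).
by rewrite /form_eval -rowE trmx_delta -colE !mxE.
Qed.

Lemma is_diff_form_eval (V : normedModType C) (W dW : V -> 'M[C]_m)
    (X dX Y dY : V -> 'rV[C]_m) x :
  is_diff x W dW -> is_diff x X dX -> is_diff x Y dY ->
  is_diff x (fun y => form_eval (W y) (X y) (Y y))
    (fun h => form_eval (dW h) (X x) (Y x) + form_eval (W x) (dX h) (Y x)
              + form_eval (W x) (X x) (dY h)).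
Proof.
move=> hW hX hY.
have [D dE] := is_diff_coord 0 0
  (is_diff_mulmx (is_diff_mulmx hX hW) (is_diff_trmx hY)).
apply: DiffDef; first exact: D.
rewrite [LHS]dE; apply/funext => h.
by rewrite /form_eval mulmxDl mxE [in LHS]mxE [X in X + _]addrC.
Qed.

End FormEval.

(** * Covariant derivatives of 2-forms *)

Section CovariantForm.
Context {C : numFieldType} {m : nat} {M : complex_manifold C m}.
Implicit Types (x : M) (U : set M) (w : M -> 'M[C]_m) (X Y Z : M -> 'rV[C]_m).
Local Notation hol_fun := (holomorphic_on (@fun_rep _ _ M)).
Local Notation hol_vec := (holomorphic_on (@vec_rep _ _ M)).
Local Notation hol_form := (holomorphic_on (@form_rep _ _ M)).
Local Notation chart x := (mf_at x).

Lemma is_diff_differential U (f : M -> C) x : U x -> hol_fun U f ->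
  is_diff (mf_phi (chart x) x) (in_chart (@fun_rep _ _ M) (chart x) f)
    (differential f x).
Proof.
by move=> Ux hf; apply/differentiableP/hf => //; exact: mf_atP.
Qed.

Lemma differential_eq U (f g : M -> C) x v : open U -> U x -> hol_fun U f ->
  (forall y, U y -> f y = g y) -> differential f x v = differential g x v.
Proof.
move=> oU Ux hf fg; apply/esym.
have [_ /(congr1 (@^~ v))] // : is_diff (mf_phi (chart x) x)
    (in_chart (@fun_rep _ _ M) (chart x) g) (differential f x).
apply: is_diff_near_eq (is_diff_differential Ux hf).
have := near_chart oU Ux (mf_atP x); apply: filterS => z [Uz _ _].
by rewrite /in_chart /fun_rep fg.
Qed.

Lemma differential_cst (c : C) x v : differential (fun=> c) x v = 0.
Proof. by rewrite /differential diff_cst. Qed.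

Lemma differential_sum U (I : finType) (a : I -> C) (f : I -> M -> C) x v :
  U x -> (forall k, hol_fun U (f k)) ->
  differential (fun y => \sum_k a k * f k y) x v =
  \sum_k a k * differential (f k) x v.
Proof.
move=> Ux hf.
have [_ /(congr1 (@^~ v))] // : is_diff (mf_phi (chart x) x)
    (in_chart (@fun_rep _ _ M) (chart x) (fun y => \sum_k a k * f k y))
    (fun v => \sum_k a k * differential (f k) x v).
apply: is_diff_sum => k.
exact: (is_diffZ (a k) (is_diff_differential Ux (hf k))).
Qed.

Lemma differentialD U (f g : M -> C) x v :
  U x -> hol_fun U f -> hol_fun U g ->
  differential (fun y => f y + g y) x v = differential f x v + differential g x v.
Proof.
move=> Ux hf hg.
have [_ /(congr1 (@^~ v))] // :=
  is_diffD (is_diff_differential Ux hf) (is_diff_differential Ux hg).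
Qed.

Lemma differentialN U (f : M -> C) x v : U x -> hol_fun U f ->
  differential (fun y => - f y) x v = - differential f x v.
Proof.
move=> Ux hf.
have [_ /(congr1 (@^~ v))] // := is_diffN (is_diff_differential Ux hf).
Qed.

(** Product rule in the chart [i]: by [form_eval_rep] the three factors may be replaced by their
    chart representatives. *)
Lemma is_diff_eval U w X Y i x :
  open U -> U x -> mf_dom i x -> hol_form U w -> hol_vec U X -> hol_vec U Y ->
  is_diff (mf_phi i x)
    (in_chart (@fun_rep _ _ M) i (fun y => form_eval (w y) (X y) (Y y)))
    (fun v =>
      form_eval ('d (in_chart (@form_rep _ _ M) i w) (mf_phi i x) v)
        (vec_rep i x (X x)) (vec_rep i x (Y x))
      + form_eval (form_rep i x (w x))
        ('d (in_chart (@vec_rep _ _ M) i X) (mf_phi i x) v) (vec_rep i x (Y x))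
      + form_eval (form_rep i x (w x)) (vec_rep i x (X x))
        ('d (in_chart (@vec_rep _ _ M) i Y) (mf_phi i x) v)).
Proof.
move=> oU Ux ix hw hX hY.
have := is_diff_form_eval (differentiableP (hw i x Ux ix))
  (differentiableP (hX i x Ux ix)) (differentiableP (hY i x Ux ix)).
rewrite /in_chart mf_phiK//; apply: is_diff_near_eq.
have := near_chart oU Ux ix; apply: filterS => z [_ iz _].
by rewrite form_eval_rep.
Qed.

Lemma holomorphic_eval U w X Y :
  open U -> hol_form U w -> hol_vec U X -> hol_vec U Y ->
  hol_fun U (fun y => form_eval (w y) (X y) (Y y)).
Proof. by move=> oU hw hX hY i x Ux ix; case: (is_diff_eval oU Ux ix hw hX hY). Qed.

Lemma differential_eval U w X Y x v :
  open U -> U x -> hol_form U w -> hol_vec U X -> hol_vec U Y ->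
  let z := mf_phi (chart x) x in
  differential (fun y => form_eval (w y) (X y) (Y y)) x v =
    form_eval ('d (in_chart (@form_rep _ _ M) (chart x) w) z v) (X x) (Y x)
    + form_eval (w x) ('d (in_chart (@vec_rep _ _ M) (chart x) X) z v) (Y x)
    + form_eval (w x) (X x) ('d (in_chart (@vec_rep _ _ M) (chart x) Y) z v).
Proof.
move=> oU Ux hw hX hY z.
have [_ /(congr1 (@^~ v))] := is_diff_eval oU Ux (mf_atP x) hw hX hY.
by rewrite !vec_rep_at form_rep_at.
Qed.

Section Connection.
Context {nabla : (M -> 'rV[C]_m) -> M -> 'M[C]_m}.
Local Notation cov := (covariant_form nabla).

Lemma covariant_form_skew U w X Y x v : open U -> U x -> hol_form U w ->
  hol_vec U X -> hol_vec U Y -> (forall y, (w y)^T = - w y) ->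
  cov w X Y x v = - cov w Y X x v.
Proof.
move=> oU Ux hw hX hY wT; rewrite /covariant_form.
rewrite (form_eval_skew _ (Y x)) // (form_eval_skew (X x)) //.
have -> : (fun y => form_eval (w y) (X y) (Y y)) =
    fun y => - form_eval (w y) (Y y) (X y).
  by apply/funext => y; rewrite form_eval_skew.
rewrite (differentialN _ Ux); last exact: holomorphic_eval.
by rewrite !opprD !opprK addrAC.
Qed.

Lemma covariant_form_addv w X Y x u v :
  cov w X Y x (u + v) = cov w X Y x u + cov w X Y x v.
Proof.
rewrite /covariant_form !mulmxDl form_evalDl form_evalDr.
rewrite [differential _ x (u + v)]linearD -!/(differential _ x _).
ring.
Qed.

Lemma covariant_form_sum U (I : finType) (a : I -> C) (w : I -> M -> 'M[C]_m)
    X Y x v : open U -> U x -> (forall k, hol_form U (w k)) ->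
  hol_vec U X -> hol_vec U Y ->
  cov (fun y => \sum_k a k *: w k y) X Y x v = \sum_k a k * cov (w k) X Y x v.
Proof.
move=> oU Ux hw hX hY; rewrite /covariant_form.
under eq_fun do rewrite form_eval_sum.
rewrite (differential_sum _ _ Ux); last by move=> k; exact: holomorphic_eval.
rewrite !form_eval_sum -!sumrB; apply: eq_bigr => k _.
by rewrite -!mulrBr.
Qed.

Lemma covariant_form0 X Y x v : cov (fun=> 0) X Y x v = 0.
Proof.
rewrite /covariant_form !form_eval0 !subr0.
by under eq_fun do rewrite form_eval0; exact: differential_cst.
Qed.

Lemma covariant_form_splitl U w X X' X'' Y x v :
  holomorphic_connection nabla -> open U -> U x -> hol_form U w ->
  hol_vec U X -> hol_vec U X' -> hol_vec U X'' -> hol_vec U Y ->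
  (forall y, U y -> X y = X' y + X'' y) ->
  cov w X Y x v = cov w X' Y x v + cov w X'' Y x v.
Proof.
move=> hn oU Ux hw hX hX' hX'' hY XE; rewrite /covariant_form.
have hXY := holomorphic_eval oU hw hX hY.
(* [X] and [X' + X''] agree only on [U], so locality of the connection is used together with
   additivity. *)
have -> : nabla X x = nabla X' x + nabla X'' x.
  rewrite -(con_add hn oU hX' hX'')//; apply: (con_local hn oU) => //.
  exact: holomorphic_vecD.
rewrite (differential_eq (g := fun y => form_eval (w y) (X' y) (Y y) +
  form_eval (w y) (X'' y) (Y y)) _ oU Ux hXY); last first.
  by move=> y Uy; rewrite XE// form_evalDl.
rewrite (differentialD _ Ux); try exact: holomorphic_eval.
rewrite XE// mulmxDr !form_evalDl.
move: (differential _ _ _) (differential _ _ _) => d' d''.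
move: (form_eval _ _ _) (form_eval _ _ _) (form_eval _ _ _) (form_eval _ _ _).
by move=> c1 c2 c3 c4; ring.
Qed.

(* Writing [cov] in the chart, the terms with derivatives of X, Y, Z assemble
   into torsion, and what remains is the exterior derivative. *)
Lemma closed_covariant_form_cyclic U w X Y Z x :
  torsion_free nabla -> closed_holomorphic_2form w -> open U -> U x ->
  hol_vec U X -> hol_vec U Y -> hol_vec U Z ->
  cov w X Y x (Z x) + cov w Y Z x (X x) + cov w Z X x (Y x) = 0.
Proof.
move=> tf [wT hw dw] oU Ux hX hY hZ.
have hwU : hol_form U w by apply: holomorphic_onS hw.
rewrite /covariant_form !(differential_eval _ oU Ux)//.
rewrite -(dw x (X x) (Y x) (Z x)) /exterior_derivative.
have := tf U X Y oU hX hY x Ux; have := tf U Y Z oU hY hZ x Ux.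
have := tf U Z X oU hZ hX x Ux.
rewrite /lie_bracket !in_chart_at !vec_rep_at.
(* Once the three torsion identities are substituted, each remaining covariant derivative occurs
   twice, and the two occurrences cancel by skew-symmetry. *)
move=> /eqP; rewrite subr_eq => /eqP ->.
move=> /eqP; rewrite subr_eq => /eqP ->.
move=> /eqP; rewrite subr_eq => /eqP ->.
rewrite !form_evalDl !form_evalNl.
set dW := 'd (in_chart _ _ w) _; set dX := 'd (in_chart _ _ X) _.
set dY := 'd (in_chart _ _ Y) _; set dZ := 'd (in_chart _ _ Z) _.
have sk := fun u v => @form_eval_skew _ _ (w x) u v (wT x).
(* Each undifferentiated field is moved to the second slot of [w x]; it stands in the first slot of
   two terms. *)
rewrite (sk (X x)) (sk (X x)) (sk (Y x)) (sk (Y x)) (sk (Z x)) (sk (Z x)).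
ring.
Qed.

End Connection.
End CovariantForm.

(** * Local frames of sub-bundles *)

Section Subbundles.
Context {C : numFieldType} {m : nat} {M : complex_manifold C m}.
Implicit Types (x : M) (U : set M) (X Y : M -> 'rV[C]_m).
Implicit Types (E : M -> {vspace 'rV[C]_m}).
Local Notation hol_vec := (holomorphic_on (@vec_rep _ _ M)).
Local Notation subbundle := (holomorphic_subbundle (@vec_rep _ _ M)).

Lemma basis_combination (vT : vectType C) (r : nat) (A : {vspace vT})
    (s : 'I_r -> vT) : basis_of A [tuple s k | k < r] ->
  forall v, v \in A -> exists c : 'I_r -> C, v = \sum_k c k *: s k.
Proof.
move=> bs v vA; exists (fun k => coord [tuple s k | k < r] k v).
rewrite {1}(coord_basis bs vA); apply: eq_bigr => k _.
by rewrite -tnth_nth tnth_mktuple.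
Qed.

Lemma basis_memE (vT : vectType C) (r : nat) (A : {vspace vT})
    (s : 'I_r -> vT) : basis_of A [tuple s k | k < r] -> forall k, s k \in A.
Proof.
by move=> bs k; apply: (basis_mem bs); rewrite -(tnth_mktuple s k) mem_tnth.
Qed.

Lemma subbundle_dim (r : nat) E x : subbundle r E -> \dim (E x) = r.
Proof. by move=> /(_ x)[U [_ Ux [s _ /(_ x Ux)]]] /size_basis. Qed.

(** The vector is extended with constant coefficients in a local frame, so that identities between
    vector fields can be applied to it. *)
Lemma subbundle_extension (r : nat) E x v : subbundle r E -> v \in E x ->
  exists U X, [/\ open U, U x, hol_vec U X, forall y, U y -> X y \in E y
    & X x = v].
Proof.
move=> /(_ x)[U [oU Ux [s hs bs]]] /(basis_combination (bs _ Ux))[c vE].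
exists U, (fun y => \sum_k c k *: s k y); split => //.
  exact: holomorphic_combination.
move=> y Uy; apply: memv_suml => k _; apply: memvZ.
exact: (basis_memE (bs y Uy)).
Qed.

(** The diagonal matrix keeps the frame components whose index satisfies [P] and kills the
    others. *)
Lemma subframe_mem (P : pred 'I_m) (e : 'I_m -> M -> 'rV[C]_m)
    (A : {vspace 'rV[C]_m}) (u : 'rV[C]_m) (y : M) :
  (forall k, P k -> e k y \in A) ->
  u *m diag_mx (\row_k (P k)%:R) *m frame_mx e y \in A.
Proof.
move=> eA; rewrite mulmx_sum_row; apply: memv_suml => k _.
rewrite rowK mul_mx_diag !mxE.
by have [/eA/memvZ|_] := boolP (P k); [exact | rewrite mulr0 scale0r mem0v].
Qed.

Lemma diag_predC (P : pred 'I_m) :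
  diag_mx (\row_k (P k)%:R) + diag_mx (\row_k (~~ P k)%:R) = 1%:M :> 'M[C]_m.
Proof.
apply/matrixP => k l; rewrite !mxE -mulrnDl.
by case: (P _); rewrite ?addr0 ?add0r.
Qed.

End Subbundles.

(** * Splitting of vector fields along complementary sub-bundles *)

Section Splitting.
Context {C : numFieldType} {n : nat} {M : complex_manifold C n.*2}.
Implicit Types (x : M) (U : set M) (X Y : M -> 'rV[C]_n.*2).
Implicit Types (E : M -> {vspace 'rV[C]_n.*2}).
Local Notation hol_vec := (holomorphic_on (@vec_rep _ _ M)).
Local Notation subbundle := (holomorphic_subbundle (@vec_rep _ _ M)).

Lemma complement_addv (A B : {vspace 'rV[C]_n.*2}) :
  \dim A = n -> \dim B = n -> (A :&: B = 0)%VS -> (A + B)%VS = fullv.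
Proof.
move=> dA dB AB0; apply/eqP; rewrite eqEdim subvf /= dimv_disjoint_sum//.
by rewrite dA dB dimvf /dim /= mul1n addnn.
Qed.

Lemma complement_decomp (A B : {vspace 'rV[C]_n.*2}) (v : 'rV[C]_n.*2) :
  \dim A = n -> \dim B = n -> (A :&: B = 0)%VS ->
  exists a b, [/\ a \in A, b \in B & v = a + b].
Proof.
move=> dA dB AB0; have : v \in (A + B)%VS by rewrite complement_addv// memvf.
by case/memv_addP => a aA [b bB ->]; exists a, b.
Qed.

(** Local frames of [E] and [E'] together form a frame of the tangent bundle, and [X'] and [X'']
    collect the components of [X] along its two halves. The splitting is local because the frames
    are. *)
Lemma holomorphic_splitting E E' U X x :
  subbundle n E -> subbundle n E' -> (forall y, E y :&: E' y = 0)%VS ->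
  open U -> U x -> hol_vec U X ->
  exists V X' X'', [/\ open V, V x & V `<=` U] /\
    [/\ hol_vec V X', hol_vec V X'', forall y, V y -> X' y \in E y,
      forall y, V y -> X'' y \in E' y & forall y, V y -> X y = X' y + X'' y].
Proof.
move=> sE sE' EE' oU Ux hX.
have [U1 [oU1 U1x [s hs bs]]] := sE x.
have [U2 [oU2 U2x [s' hs' bs']]] := sE' x.
pose V := U `&` (U1 `&` U2).
have oV : open V by apply: openI => //; exact: openI.
(* Indices below [n] carry the frame of [E], the others that of [E']. *)
pose split_ord (k : 'I_n.*2) := fintype.split (cast_ord (esym (addnn n)) k).
pose P : pred 'I_n.*2 := fun k => if split_ord k is inl _ then true else false.
pose e k : M -> 'rV[C]_n.*2 :=
  match split_ord k with inl a => s a | inr b => s' b end.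
have he k : hol_vec V (e k).
  rewrite /e; case: (split_ord k) => a.
    by apply: holomorphic_onS (hs a) => y [_ []].
  by apply: holomorphic_onS (hs' a) => y [_ []].
have eE y k : V y -> P k -> e k y \in E y.
  move=> [_ [U1y _]]; rewrite /P /e; case: (split_ord k) => // a _.
  exact: (basis_memE (bs y U1y)).
have eE' y k : V y -> ~~ P k -> e k y \in E' y.
  move=> [_ [_ U2y]]; rewrite /P /e; case: (split_ord k) => // a _.
  exact: (basis_memE (bs' y U2y)).
(* Every standard basis vector lies in [E y + E' y], hence in the row space of the combined
   frame. *)
have eu y : V y -> frame_mx e y \in unitmx.
  move=> [_ [U1y U2y]]; rewrite -row_full_unit -sub1mx; apply/row_subP => k.
  have [a [b [aE bE' ->]]] := complement_decomp (row k 1%:M)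
    (subbundle_dim y sE) (subbundle_dim y sE') (EE' y).
  have erow (j : 'I_(n + n)) : (match fintype.split j with inl a => s a y
      | inr b => s' b y end <= frame_mx e y)%MS.
    apply: (eq_row_sub (cast_ord (addnn n) j)).
    by rewrite rowK /e /split_ord cast_ordK; case: (fintype.split j).
  apply: addmx_sub.
    have [c ->] := basis_combination (bs y U1y) aE.
    apply: summx_sub => l _; apply: scalemx_sub.
    by have := erow (lshift n l); rewrite (unsplitK (inl _ l)).
  have [c ->] := basis_combination (bs' y U2y) bE'.
  apply: summx_sub => l _; apply: scalemx_sub.
  by have := erow (rshift n l); rewrite (unsplitK (inr _ l)).
have hXV : hol_vec V X by apply: holomorphic_onS hX => y [].
pose part (Q : pred 'I_n.*2) y :=
  X y *m invmx (frame_mx e y) *m diag_mx (\row_k (Q k)%:R) *m frame_mx e y.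
exists V, (part P), (part (predC P)); split; first by split => // y [].
split; try exact: holomorphic_frame_transform.
- by move=> y Vy; apply: subframe_mem => k; exact: eE.
- by move=> y Vy; apply: subframe_mem => k; exact: eE'.
move=> y Vy; rewrite /part -mulmxDl -mulmxDr diag_predC mulmx1 mulmxKV//.
exact: eu.
Qed.

End Splitting.

(** * Four sub-bundles and closed forms having them as kernels *)

Lemma ord4_complement (i j : 'I_4) : i != j -> exists k l : 'I_4,
  k != l /\ forall a, (a != i) && (a != j) = (a == k) || (a == l).
Proof.
move=> ij; have /cards2P[k [l [kl /setP klE]]] : #|~: [set i; j]%SET| == 2%N.
  by rewrite -(eqn_add2l #|[set i; j]%SET|) cardsC cards2 ij card_ord.
by exists k, l; split => // a; have := klE a; rewrite !inE negb_or.
Qed.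

Section FourSubbundles.
Context {C : numFieldType} {n : nat} {M : complex_manifold C n.*2}.
Context {E : 'I_4 -> M -> {vspace 'rV[C]_n.*2}} {w : 'I_4 -> M -> 'M[C]_n.*2}.
Context {nabla : (M -> 'rV[C]_n.*2) -> M -> 'M[C]_n.*2}.
Implicit Types (x : M) (U : set M) (X Y : M -> 'rV[C]_n.*2).
Local Notation hol_vec := (holomorphic_on (@vec_rep _ _ M)).
Hypothesis E_bundle : forall i, holomorphic_subbundle (@vec_rep _ _ M) n (E i).
Hypothesis E_disjoint : forall i j, i != j -> forall x, (E i x :&: E j x = 0)%VS.
Hypothesis w_closed : forall i, closed_holomorphic_2form (w i).
Hypothesis w_ker : forall i x v, v \in E i x <-> v *m w i x = 0.

Let decomp i j (ij : i != j) x v := complement_decomp v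
  (subbundle_dim x (E_bundle i)) (subbundle_dim x (E_bundle j))
  (E_disjoint ij x).

Lemma form_eval_kerl i x u v : u \in E i x -> form_eval (w i x) u v = 0.
Proof. by move=> /w_ker/form_eval_ker. Qed.

Lemma form_eval_kerr i x u v : v \in E i x -> form_eval (w i x) u v = 0.
Proof.
have [wT _ _] := w_closed i.
by move=> /form_eval_kerl vE; rewrite form_eval_skew// vE oppr0.
Qed.

(* On E_k x E_l only the forms w_i and w_j survive. *)
Lemma dependency_coef_eq0 (a : 'I_4 -> C) x i j : (0 < n)%N ->
  \sum_k a k *: w k x = 0 -> i != j -> a j = 0 -> a i = 0.
Proof.
move=> n0 aw ij aj0; have [k [l [kl klE]]] := ord4_complement ij.
have /andP[ki _] : (k != i) && (k != j) by rewrite klE eqxx.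
have /andP[li _] : (l != i) && (l != j) by rewrite klE eqxx orbT.
apply/eqP/negPn/negP => ai0.
have wkl u v : u \in E k x -> v \in E l x -> form_eval (w i x) u v = 0.
  move=> uk vl; apply/(mulfI ai0); rewrite mulr0.
  have := form_eval_sum a (w ^~ x) u v; rewrite aw form_eval0 (bigD1 i)//=.
  rewrite big1 ?addr0// => p pi; have [->|pj] := eqVneq p j.
    by rewrite aj0 mul0r.
  have := klE p; rewrite pi pj => /esym/orP[]/eqP ->.
    by rewrite form_eval_kerl ?mulr0.
  by rewrite form_eval_kerr ?mulr0.
(* Modulo [E i x], which [w i x] kills on either side, the first argument may be taken in [E k x]
   and the second in [E l x]. *)
have wi0 : w i x = 0.
  apply: form_eval_ext => u v.
  have [u1 [u2 [u1k u2i ->]]] := decomp ki x u.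
  have [v1 [v2 [v1l v2i ->]]] := decomp li x v.
  by rewrite form_evalDl (form_eval_kerl _ u2i) addr0 form_evalDr
    (form_eval_kerr _ v2i) addr0 wkl.
(* The zero form has the whole tangent space as kernel, which leaves no room for [E k x], of rank
   [n > 0]. *)
have iT : E i x = fullv.
  by apply/vspaceP => v; rewrite memvf; apply/w_ker; rewrite wi0 mulmx0.
have := E_disjoint ki x; rewrite iT capvf => /(congr1 (fun A => \dim A)).
by rewrite (subbundle_dim x (E_bundle k)) dimv0 => nE; rewrite nE in n0.
Qed.

Hypothesis nabla_con : holomorphic_connection nabla.
Hypothesis nabla_tf : torsion_free nabla.
Hypothesis nabla_E : forall i, preserves nabla (E i).
Local Notation cov := (covariant_form nabla).

Let w_hol i U : holomorphic_on (@form_rep _ _ M) U (w i).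
Proof. by have [_ hw _] := w_closed i; apply: holomorphic_onS hw. Qed.

Let w_skew i y : (w i y)^T = - w i y.
Proof. by have [] := w_closed i. Qed.

(** The function [w i (X, Y)] vanishes on [U], and the derivatives of [X] stay in [E i] because the
    connection preserves it; so all three terms vanish. *)
Lemma covariant_form_kerl i U X Y x v : open U -> U x ->
  hol_vec U X -> hol_vec U Y -> (forall y, U y -> X y \in E i y) ->
  cov (w i) X Y x v = 0.
Proof.
move=> oU Ux hX hY XE; rewrite /covariant_form.
rewrite (differential_eq (g := fun=> 0) _ oU Ux); last 2 first.
- exact: holomorphic_eval.
- by move=> y Uy; rewrite form_eval_kerl ?XE.
rewrite differential_cst !form_eval_kerl ?subr0// ?XE//.
exact: (nabla_E oU).
Qed.

Lemma covariant_form_kerr i U X Y x v : open U -> U x ->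
  hol_vec U X -> hol_vec U Y -> (forall y, U y -> Y y \in E i y) ->
  cov (w i) X Y x v = 0.
Proof.
move=> oU Ux hX hY YE; rewrite (covariant_form_skew _ oU Ux)//.
by rewrite (covariant_form_kerl _ oU Ux) ?oppr0.
Qed.

(** Let [Z] extend [v] inside [E i]. In the cyclic identity for [X], [Y], [Z] the two terms with [Z]
    as an argument of the form vanish, which leaves the derivative along [v]. *)
Lemma covariant_form_along_ker i U X Y x v : open U -> U x ->
  hol_vec U X -> hol_vec U Y -> v \in E i x -> cov (w i) X Y x v = 0.
Proof.
move=> oU Ux hX hY /(subbundle_extension (E_bundle i))[U' [Z [oU' U'x hZ ZE Zx]]].
have oV := openI oU oU'; have Vx : (U `&` U') x by [].
have hXV := holomorphic_onS (@subIsetl _ U U') hX.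
have hYV := holomorphic_onS (@subIsetl _ U U') hY.
have hZV := holomorphic_onS (@subIsetr _ U U') hZ.
have ZEV y : (U `&` U') y -> Z y \in E i y by move=> [_]; exact: ZE.
have := closed_covariant_form_cyclic nabla_tf (w_closed i) oV Vx hXV hYV hZV.
rewrite (covariant_form_kerr _ oV Vx hYV hZV ZEV).
rewrite (covariant_form_kerl _ oV Vx hZV hXV ZEV).
by rewrite Zx !addr0.
Qed.

Lemma covariant_form_along_other (a : 'I_4 -> C) i j U X Y x v :
  (forall y, \sum_k a k *: w k y = 0) -> a i != 0 -> i != j ->
  open U -> U x -> hol_vec U X -> hol_vec U Y -> v \in E j x ->
  cov (w i) X Y x v = 0.
Proof.
move=> aw ai0 ij oU Ux hX hY vj; have [k [l [kl klE]]] := ord4_complement ij.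
have /andP[ki _] : (k != i) && (k != j) by rewrite klE eqxx.
have /andP[li _] : (l != i) && (l != j) by rewrite klE eqxx orbT.
(* Components along [E i] contribute nothing, so [X] may be replaced by [X1] in [E k], and then [Y]
   by [Y1] in [E l]. *)
have [V1 [X1 [X2 [[oV1 V1x V1U] [hX1 hX2 X1k X2i XE]]]]] :=
  holomorphic_splitting (E_bundle k) (E_bundle i) (E_disjoint ki) oU Ux hX.
have hY1 := holomorphic_onS V1U hY.
have [V [Y1 [Y2 [[oV Vx VV1] [hY1' hY2 Y1l Y2i YE]]]]] :=
  holomorphic_splitting (E_bundle l) (E_bundle i) (E_disjoint li) oV1 V1x hY1.
have hXV := holomorphic_onS VV1 (holomorphic_onS V1U hX).
have hX1V := holomorphic_onS VV1 hX1; have hX2V := holomorphic_onS VV1 hX2.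
have hYV := holomorphic_onS VV1 hY1.
rewrite (covariant_form_splitl _ nabla_con oV Vx _ hXV hX1V hX2V hYV)//; last first.
  by move=> y /VV1; exact: XE.
rewrite (covariant_form_kerl _ oV Vx hX2V)// ?addr0; last first.
  by move=> y /VV1; exact: X2i.
(* Skew-symmetry brings [Y] to the first slot, where it can be split, and then back. *)
rewrite (covariant_form_skew _ oV)//.
rewrite (covariant_form_splitl _ nabla_con oV Vx _ hYV hY1' hY2 hX1V)//.
rewrite (covariant_form_kerl _ oV Vx hY2)// ?addr0 -(covariant_form_skew _ oV)//.
apply: (mulfI ai0); rewrite mulr0.
(* The relation is differentiated along [v] and evaluated on [X1] and [Y1]. The [j] term vanishes
   because [v] lies in [E j], the [k] and [l] terms because [X1] and [Y1] lie in the respective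
   kernels. *)
have := covariant_form_sum (nabla := nabla) a v oV Vx (w_hol ^~ V) hX1V hY1'.
under [X in cov X]eq_fun do rewrite aw.
rewrite covariant_form0 (bigD1 i)//= big1 ?addr0// => p pi.
have [->|pj] := eqVneq p j.
  by rewrite (covariant_form_along_ker oV) ?mulr0.
have := klE p; rewrite pi pj => /esym/orP[]/eqP ->.
  by rewrite (covariant_form_kerl _ oV) ?mulr0// => y /VV1; exact: X1k.
by rewrite (covariant_form_kerr _ oV) ?mulr0.
Qed.

Lemma four_forms_parallel (a : 'I_4 -> C) i :
  (forall y, \sum_k a k *: w k y = 0) -> a i != 0 -> parallel_form nabla (w i).
Proof.
move=> aw ai0 U X Y oU hX hY x v Ux.
have [j ij] : exists j, i != j.
  by have [->|i0] := eqVneq i 0; [exists 1 | exists 0].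
have [u1 [u2 [u1i u2j ->]]] := decomp ij x v.
rewrite covariant_form_addv (covariant_form_along_ker oU)//.
by rewrite (covariant_form_along_other aw ai0 ij oU)// addr0.
Qed.

End FourSubbundles.

(** * Points of the projective line with finite coordinate *)

Definition affine_vector (C : numFieldType) (c : C) : 'rV[C]_2 :=
  \row_k (if k == 0 then 1 else c).

Lemma dim_affine_line (C : numFieldType) (c : C) :
  \dim <[affine_vector c]>%VS == 1%N.
Proof.
rewrite dim_vline; case: (affine_vector c =P 0) => // /rowP/(_ 0)/eqP.
by rewrite !mxE eqxx oner_eq0.
Qed.

Definition affine_line (C : numFieldType) (c : C) : CP1 C :=
  exist _ <[affine_vector c]>%VS (dim_affine_line c).

(** The spanning vectors are normalised to first coordinate 1, so proportional ones are equal. *)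
Lemma affine_line_inj (C : numFieldType) : injective (@affine_line C).
Proof.
move=> c c' /(congr1 sval)/= cc'.
have : affine_vector c \in <[affine_vector c']>%VS by rewrite -cc' memv_line.
case/vlineP => l /rowP lE; have := lE 0; have := lE 1.
by rewrite !mxE /= mulr1 => -> <-; rewrite mul1r.
Qed.

(** * Linear relations among four combinations of three forms *)

Section SpanOfForms.
Context {C : numFieldType} {T : Type} {p : nat} {b : 'I_3 -> T -> 'M[C]_p}.
Context {w : 'I_4 -> T -> 'M[C]_p} {c : 'I_4 -> 'I_3 -> C}.
Hypothesis wE : forall i x, w i x = \sum_k c i k *: b k x.

Let cmx : 'M[C]_(4, 3) := \matrix_(i, k) c i k.

Lemma sum_coord (a : 'rV[C]_4) x :
  \sum_i a 0 i *: w i x = \sum_k (a *m cmx) 0 k *: b k x.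
Proof.
under eq_bigr do rewrite wE scaler_sumr.
rewrite exchange_big; apply: eq_bigr => k _ /=.
rewrite mxE scaler_suml; apply: eq_bigr => i _.
by rewrite mxE scalerA.
Qed.

(** A 4 by 3 matrix has a nonzero left kernel, and each kernel vector is a relation with constant
    coefficients. *)
Lemma four_forms_dependent : exists2 a : 'I_4 -> C, (exists i, a i != 0) &
  forall x, \sum_i a i *: w i x = 0.
Proof.
have : kermx cmx != 0.
  rewrite -mxrank_eq0 mxrank_ker subn_eq0 -ltnNge.
  by apply: leq_ltn_trans (rank_leq_col _) _.
case/rowV0Pn => a /sub_kermxP ac a0; exists (fun i => a 0 i).
  by case/rV0Pn: a0 => i ai; exists i.
by move=> x; rewrite sum_coord ac big1// => k _; rewrite mxE scale0r.
Qed.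

(** By hypothesis a relation with one zero coefficient is trivial, so the left kernel of the
    coordinate matrix has rank at most 1. The matrix then has rank 3, and its rows span all
    coordinate vectors. *)
Lemma forms_span :
  (forall (a : 'I_4 -> C) i j, (forall x, \sum_k a k *: w k x = 0) ->
     i != j -> a j = 0 -> a i = 0) ->
  forall d : 'I_3 -> C, exists a : 'I_4 -> C,
    forall x, \sum_k d k *: b k x = \sum_i a i *: w i x.
Proof.
move=> coef0 d.
have k1 : (\rank (kermx cmx) <= 1)%N.
  (* Multiplication by [col0] reads off coefficient 0. It is injective on the left kernel and takes
     values in a line. *)
  pose col0 : 'cV[C]_4 := delta_mx 0 0.
  rewrite -(mxrank_mul_ker _ col0) (_ : kermx cmx :&: kermx col0 = 0)%MS.
    by rewrite mxrank0 addn0 rank_leq_col.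
  apply/eqP/rowV0P => u; rewrite sub_capmx => /andP[/sub_kermxP uc /sub_kermxP].
  rewrite -colE => /rowP/(_ 0); rewrite !mxE => u0.
  apply/rowP => i; rewrite mxE; have [->|i0] := eqVneq i 0; first exact: u0.
  apply: (coef0 (u 0) i 0) => // x; rewrite sum_coord uc big1// => k _.
  by rewrite mxE scale0r.
have : row_full cmx.
  move: k1; rewrite mxrank_ker leq_subLR addn1 ltnS => k3.
  by rewrite /row_full eqn_leq rank_leq_col k3.
move=> /(submx_full (\row_k d k))/submxP[a aE]; exists (fun i => a 0 i) => x.
by rewrite sum_coord -aE; apply: eq_bigr => k _; rewrite mxE.
Qed.

End SpanOfForms.

(** * Choice of four points and passage to the whole space of forms *)

Theorem theorem6 (R : realType) (n : nat) (M : complex_manifold R[i] n.*2)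
    (Om : set (M -> 'M[R[i]]_n.*2))
    (S : CP1 R[i] -> M -> {vspace 'rV[R[i]]_n.*2})
    (nabla : (M -> 'rV[R[i]]_n.*2) -> M -> 'M[R[i]]_n.*2)
    (hOm : trisymplectic Om)
    (hS : sl2_web S)
    (hgen : generates_web S Om)
    (hnabla : chern_connection S nabla) :
  forall w : M -> 'M[R[i]]_n.*2, Om w -> parallel_form nabla w.
Proof.
move=> w Omw U X Y oU hX hY x v Ux.
(* The three-dimensional evaluation at the given point [x] excludes rank zero. *)
have n0 : (0 < n)%N.
  have [V [_ dV _ _ _]] := tri_eval hOm x.
  have : (3 <= n.*2 * n.*2)%N.
    by rewrite -[X in (X <= _)%N]dV (leq_trans (dimvS (subvf V)))// dimvf.
  by rewrite lt0n; apply: contraTneq => ->.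
have [ncon ntf nS] := hnabla.
(* The points of coordinates 0, 1, 2, 3, distinct in characteristic zero. *)
pose p (i : 'I_4) : CP1 R[i] := affine_line (i%:R).
have p_neq i j : i != j -> p i <> p j.
  by move=> /eqP ij /affine_line_inj/eqP; rewrite eqr_nat => /eqP/val_inj.
have /choice[f hf] : forall i : 'I_4, exists f : M -> 'M[R[i]]_n.*2,
    Om f /\ forall y u, u \in S (p i) y <-> u *m f y = 0.
  by move=> i; have [f] := hgen (p i); exists f.
have f_closed i := tri_form hOm (proj1 (hf i)).
have f_ker i := proj2 (hf i).
have S_bundle i := web_subbundle hS (p i).
have S_disjoint i j (ij : i != j) := web_disjoint hS (p_neq i j ij).
have [b [_ OmE]] := tri_dim hOm.
have /choice[c fE] : forall i, exists c : 'I_3 -> R[i],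
    f i = fun y => \sum_k c k *: b k y.
  by move=> i; have [+ _] := hf i; rewrite OmE => -[c]; exists c.
have {}fE i y : f i y = \sum_k c i k *: b k y by rewrite fE.
have coef0 (a : 'I_4 -> R[i]) i j : (forall y, \sum_k a k *: f k y = 0) ->
    i != j -> a j = 0 -> a i = 0.
  move=> /(_ x) ax.
  exact: (dependency_coef_eq0 S_bundle S_disjoint f_closed f_ker n0 ax).
have [a [i0 ai0] af] := four_forms_dependent fE.
have f_parallel i : parallel_form nabla (f i).
  apply: (four_forms_parallel S_bundle S_disjoint f_closed f_ker ncon ntf _ af).
    by move=> j; exact: nS.
  (* If [a i] vanished, so would [a i0], which is nonzero by choice. *)
  have [->//|ii0] := eqVneq i i0; apply: contra ai0 => /eqP ai.
  by rewrite (coef0 a i0 i)// eq_sym.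
move: Omw; rewrite OmE => -[d ->].
have [a' dE] := forms_span fE coef0 d.
(* As the coefficients [a'] are constant, the covariant derivative passes through the combination of
   the parallel forms [f k]. *)
under [X in covariant_form _ X]eq_fun do rewrite dE.
rewrite (covariant_form_sum _ _ oU Ux)// => [|k].
  by rewrite big1// => k _; rewrite (f_parallel k U)// mulr0.
by have [_ fh _] := f_closed k; apply: holomorphic_onS fh.
Qed.
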